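(* Let $(f_1,\ldots,f_N;p_1,\ldots,p_N)$ be an admissible iterated function system and let $P$ be the corresponding Markov operator. Then $P$ has a unique invariant measure $\mu_*\in\mathcal M_1((0,1))$, i.e. there is exactly one $\mu_*\in\mathcal M_1((0,1))$ with $P\mu_*=\mu_*$. Moreover, $\mu_*$ is atomless, i.e. $\mu_*(\{x\})=0$ for every $x\in(0,1)$.
   Context: $H^+$ denotes the set of increasing homeomorphisms $f:[0,1]\to[0,1]$ that are $C^1$ in a neighbourhood (in $[0,1]$) of $0$ and of $1$. Let $f_1,\ldots,f_N\in H^+$ be finitely many homeomorphisms and let $(p_1,\ldots,p_N)$ satisfy $p_i>0$ for all $i$ and $\sum_{i=1}^N p_i=1$. The family $(f_1,\ldots,f_N;p_1,\ldots,p_N)$ is called an admissible iterated function system if: (1) for every $x\in(0,1)$ there are $i,j\in\{1,\ldots,N\}$ with $f_i(x)<x<f_j(x)$; (2) $f_i'(0)>0$ and $f_i'(1)>0$ for all $i$, and $\sum_{i=1}^N p_i\log f_i'(0)>0$ and $\sum_{i=1}^N p_i\log f_i'(1)>0$. The corresponding Markov operator $P$ acts on finite Borel measures on $[0,1]$ by $P\mu(A)=\sum_{i=1}^N p_i\,\mu(f_i^{-1}(A))$ for Borel $A\subseteq[0,1]$. $\mathcal M_1((0,1))$ is the set of Borel probability measures on $(0,1)$, identified with the Borel probability measures $\mu$ on $[0,1]$ satisfying $\mu(\{0,1\})=0$. *)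

(* Defs.v *)
From mathcomp Require Import all_boot all_order all_algebra.
From mathcomp Require Import all_classical all_reals all_analysis.

Set Implicit Arguments.
Unset Strict Implicit.
Unset Printing Implicit Defensive.

Import Order.TTheory GRing.Theory Num.Theory.
Import numFieldNormedType.Exports.

Local Open Scope classical_set_scope.
Local Open Scope ring_scope.

(* A map of [0, 1] is represented by a function R -> R of which only the values
   on [0, 1] matter. *)

Section maps_of_the_unit_interval.
Context {R : realType}.
Implicit Types (f : R -> R) (a x : R).

(* Derivatives relative to [0, 1], hence one-sided at the two endpoints. *)
Definition quotient01 f x : R -> R := fun y => (f y - f x) / (y - x).

Definition derivable01 f x : Prop :=
  cvg (quotient01 f x y @[y --> within `[0, 1] x^']).

Definition deriv01 f x : R :=
  lim (quotient01 f x y @[y --> within `[0, 1] x^']).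

Definition C1_near01 f a : Prop :=
  exists U : set R, [/\ open_nbhs a U,
    (forall x, (`[0, 1] `&` U) x -> derivable01 f x) &
    {within `[0, 1] `&` U, continuous (deriv01 f)}].

Definition homeomorphism01 f : Prop :=
  {within `[0, 1], continuous f} /\
  exists g : R -> R, [/\ {within `[0, 1], continuous g},
    set_fun `[0, 1] `[0, 1] f, set_fun `[0, 1] `[0, 1] g,
    {in `[0, 1], cancel f g} & {in `[0, 1], cancel g f}].

Definition Hplus f : Prop :=
  [/\ homeomorphism01 f,
      {in `[0, 1] &, {homo f : x y / x < y}},
      C1_near01 f 0 & C1_near01 f 1].

End maps_of_the_unit_interval.

Section iterated_function_systems.
Context {R : realType} {N : nat}.
Implicit Types (f : 'I_N -> R -> R) (p : 'I_N -> R).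

Record admissible f p : Prop := Admissible {
  adm_Hplus : forall i, Hplus (f i) ;
  adm_prob_gt0 : forall i, 0 < p i ;
  adm_prob_sum : \sum_(i < N) p i = 1 ;
  adm_move : forall x, 0 < x < 1 -> exists i j, f i x < x < f j x ;
  adm_deriv0_gt0 : forall i, 0 < deriv01 (f i) 0 ;
  adm_deriv1_gt0 : forall i, 0 < deriv01 (f i) 1 ;
  adm_lyapunov0 : 0 < \sum_(i < N) p i * ln (deriv01 (f i) 0) ;
  adm_lyapunov1 : 0 < \sum_(i < N) p i * ln (deriv01 (f i) 1)
}.

(* A Borel measure on [0, 1] is represented by a Borel measure on R that
   vanishes outside [0, 1]; intersecting with [0, 1] makes the preimage the one
   under the map of [0, 1]. *)
Definition markov_op f p (mu : set R -> \bar R) : set R -> \bar R :=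
  fun A => (\sum_(i < N) (p i)%:E * mu (`[0%R, 1%R] `&` f i @^-1` A))%E.

End iterated_function_systems.

Section measures.
Context {R : realType}.

Definition in_M1_open01 (mu : probability (measurableTypeR R) R) : Prop :=
  mu (~` `[0, 1]) = 0%E /\ mu [set 0; 1] = 0%E.

(* Measures are functions on all sets in the library, only their values on
   Borel sets are significant. *)
Definition eq_borel01 (mu nu : set R -> \bar R) : Prop :=
  forall A : set (measurableTypeR R),
    measurable A -> A `<=` `[0, 1] -> mu A = nu A.

End measures.

(* Main.v *)
Require Import Defs.
From HB Require Import structures.
From mathcomp Require Import all_boot all_order all_algebra.
From mathcomp Require Import all_classical all_reals all_analysis.
From mathcomp Require Import measurable_realfun ring lra.
Import Order.TTheory GRing.Theory Num.Theory.
Import numFieldNormedType.Exports.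
Local Open Scope classical_set_scope.
Local Open Scope ring_scope.

(* With g_i = f_i^-1, a probability measure on (0, 1) is stationary iff its
   distribution function F is harmonic: F = T F where T H = sum_i p_i H(g_i).
   The drift conditions say that the g_i contract on average at both endpoints,
   so for a small exponent a the function min(1, (x/d)^a) is T-superharmonic and
   its mirror image 1 - min(1, ((1 - x)/d)^a) is T-subharmonic and below it.
   Iterating T on the former yields a harmonic distribution function squeezed
   between the two, which forces it to tend to 0 at 0 and to 1 at 1.
   Uniqueness and the absence of atoms come from a maximum principle: if D <= T D
   on (0, 1) and D tends to 0 at both ends, then D <= 0. It is applied to
   D = |F - F'| for two stationary distribution functions, and to D(x) = mu{x}. *)

(** * Averaging over inverse maps: barriers and the maximum principle *)

Section backward_averaging.
Context (R : realType) (N : nat) (p : 'I_N -> R).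
Hypothesis p_gt0 : forall i, 0 < p i.
Hypothesis p_sum : \sum_(i < N) p i = 1.
Implicit Types (H : R -> R) (g : 'I_N -> R -> R) (xi : 'I_N -> R).

Lemma average_cst (c : R) : \sum_(i < N) p i * c = c.
Proof. by rewrite -mulr_suml p_sum mul1r. Qed.

Lemma ler_average xi1 xi2 : (forall i, xi1 i <= xi2 i) ->
  \sum_(i < N) p i * xi1 i <= \sum_(i < N) p i * xi2 i.
Proof. by move=> h; apply: ler_sum => i _; rewrite ler_pM2l. Qed.

Lemma average_lt xi (c e : R) j : (forall i, xi i <= c) -> xi j <= c - e ->
  \sum_(i < N) p i * xi i <= c - p j * e.
Proof.
move=> xic xij; rewrite -(average_cst c) (bigD1 j)//= [X in _ <= X - _](bigD1 j)//=.
rewrite addrAC lerD//; last by apply: ler_sum => i _; rewrite ler_pM2l.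
by rewrite -mulrBr ler_pM2l.
Qed.

(** Inverting 1 - u <= exp(-u) bounds exp u by 1 / (1 - u), and (1 + u + 2u^2)(1 - u) = 1 + u^2 (1 -
    2u) >= 1 for u <= 1/2. *)
Lemma expR_le_quadratic (u : R) : `|u| <= 2^-1 -> expR u <= 1 + u + 2 * u ^+ 2.
Proof.
rewrite ler_norml => /andP[u1 u2].
have h : 1 - u <= expR (- u) by exact: expR_ge1Dx.
have u3 : 0 < 1 - u by lra.
have : expR u <= (1 - u)^-1.
  by rewrite -[expR u]invrK -expRN lef_pV2 ?posrE ?expR_gt0.
move=> /le_trans; apply.
rewrite -(ler_pM2r u3) mulVf ?gt_eqF//.
have -> : (1 + u + 2 * u ^+ 2) * (1 - u) = 1 + u ^+ 2 * (1 - 2 * u) by ring.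
by rewrite lerDl mulr_ge0 ?sqr_ge0//; lra.
Qed.

(** As a function of a, the exponential average equals 1 at a = 0 and has the negative drift as its
    derivative there. The quadratic bound on [expR] yields an explicit a. *)
Lemma exponent_of_negative_drift xi : \sum_(i < N) p i * xi i < 0 ->
  exists2 a : R, 0 < a & \sum_(i < N) p i * expR (a * xi i) <= 1.
Proof.
set s := \sum_(i < N) _ => s_lt0.
pose B := 1 + \sum_(i < N) `|xi i|.
have B1 : 1 <= B by rewrite lerDl sumr_ge0.
have xiB i : `|xi i| <= B.
  by rewrite /B (bigD1 i)//= addrCA lerDl addr_ge0// sumr_ge0.
(* The first bound gives |a xi_i| <= 1/2, as the quadratic estimate requires; the second makes the
   quadratic term 2 a^2 B^2 at most -a s. *)
pose a := Num.min ((2 * B)^-1) (- s / (2 * B ^+ 2)).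
have B0 : 0 < B by lra.
have a_gt0 : 0 < a.
  by rewrite lt_min invr_gt0 divr_gt0 ?mulr_gt0 ?exprn_gt0 ?oppr_gt0//.
exists a => //.
have axi i : expR (a * xi i) <= 1 + a * xi i + 2 * a ^+ 2 * B ^+ 2.
  apply: (le_trans (@expR_le_quadratic _ _)).
    rewrite normrM gtr0_norm//.
    have a2 : a <= (2 * B)^-1 by rewrite ge_min lexx.
    apply: (le_trans (ler_pM _ _ a2 (xiB i))) => //; first exact: ltW.
    by rewrite invfM mulfVK// gt_eqF.
  rewrite lerD2l exprMn mulrA ler_pM2l ?mulr_gt0 ?exprn_gt0//.
  by rewrite -(real_normK (num_real (xi i))) lerXn2r ?nnegrE// ltW.
apply: (le_trans (ler_average _ _ axi)).
under eq_bigr do rewrite !mulrDr mulr1 mulrCA.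
rewrite !big_split /= p_sum average_cst -mulr_sumr -/s -addrA gerDl.
have -> : a * s + 2 * a ^+ 2 * B ^+ 2 = a * (s + a * (2 * B ^+ 2)) by ring.
rewrite pmulr_rle0// -lerBrDl sub0r -ler_pdivlMr ?mulr_gt0 ?exprn_gt0//.
by rewrite ge_min lexx orbT.
Qed.

(* Right continuity, for a nondecreasing H. *)
Definition right_approx H := forall x e : R, 0 < e -> exists2 y, x < y & H y <= H x + e.

(** The function q(x) = (x/d)^a is homogeneous of degree a, so q(g_i x) <= k_i^a q(x) near 0, and a
    is chosen so that the average of the k_i^a is at most 1. From d on, the barrier is 1, its
    largest value. *)
Lemma power_barrier g (k : 'I_N -> R) (r : R) : 0 < r -> (forall i, 0 < k i) ->
  \sum_(i < N) p i * ln (k i) < 0 ->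
  (forall i (x : R), x <= 0 -> g i x <= 0) ->
  (forall i (x : R), 0 < x < r -> g i x <= k i * x) ->
  exists H, [/\ {homo H : x y / x <= y}, right_approx H,
    (forall x : R, x <= 0 -> H x = 0), (forall x : R, 2^-1 <= x -> H x = 1) &
    (forall x, \sum_(i < N) p i * H (g i x) <= H x)].
Proof.
move=> r_gt0 k_gt0 drift g_le0 g_lek.
have [a a_gt0 a_le1] := exponent_of_negative_drift _ drift.
(* The cap 1/2 makes the barrier reach 1 by the midpoint; this later keeps it above the mirror image
   of the barrier at the other endpoint. *)
pose d := Num.min r (2^-1).
have d_gt0 : 0 < d by rewrite lt_min r_gt0; lra.
pose q (x : R) : R := (Num.max 0 x / d) `^ a.
have q_ge0 x : 0 <= q x by exact: powR_ge0.
have maxd x : Num.max 0 x / d \is Num.nneg.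
  by rewrite nnegrE divr_ge0 ?le_max ?lexx// ltW.
have q_homo x y : x <= y -> q x <= q y.
  move=> xy; apply: ge0_ler_powR => //; first exact: ltW.
  by rewrite ler_pM2r ?invr_gt0// ge_max !le_max lexx xy orbT.
have q0 (x : R) : x <= 0 -> q x = 0.
  by move=> x0; rewrite /q max_l// mul0r powR0// gt_eqF.
have a_neq0 : a != 0 by rewrite gt_eqF.
have pow1 : 1 `^ a = 1 by rewrite powR1.
have q1 (x : R) : d <= x -> 1 <= q x.
  move=> dx; rewrite -[leLHS]pow1 /q.
  apply: ge0_ler_powR; rewrite ?maxd// ?nnegrE//; first exact: ltW.
  by rewrite ler_pdivlMr// mul1r le_max dx orbT.
have q1' (x : R) : x <= d -> q x <= 1.
  move=> dx; rewrite -[leRHS]pow1 /q.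
  apply: ge0_ler_powR; rewrite ?maxd// ?nnegrE//; first exact: ltW.
  by rewrite ler_pdivrMr// mul1r ge_max dx ltW.
have d2 : d <= 2^-1 by rewrite ge_min lexx orbT.
exists (fun x : R => Num.min 1 (q x)); split => /=.
- by move=> x y xy; rewrite le_min !ge_min lexx q_homo// orbT.
(* The witness y is where q reaches the value q x + e. *)
- move=> x e e_gt0; exists (d * (q x + e) `^ a^-1); last first.
    have y_gt0 : 0 <= d * (q x + e) `^ a^-1 by rewrite mulr_ge0 ?powR_ge0// ltW.
    suff -> : q (d * (q x + e) `^ a^-1) = q x + e.
      rewrite ge_min; case: (leP 1 (q x)) => [_|_]; rewrite ?lexx ?orbT//.
      by rewrite lerDl ltW.
    rewrite {1}/q max_r// mulrAC divff ?gt_eqF// mul1r -powRrM mulVf ?gt_eqF//.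
    by rewrite powRr1// addr_ge0// ltW.
  have xm : x <= Num.max 0 x by rewrite le_max lexx orbT.
  apply: (le_lt_trans xm); rewrite mulrC -ltr_pdivrMr//.
  rewrite -[ltLHS]powRr1; last by rewrite -nnegrE.
  rewrite -(divff a_neq0) powRrM; apply: gt0_ltr_powR.
  + by rewrite invr_gt0.
  + by rewrite nnegrE q_ge0.
  + by rewrite nnegrE addr_ge0// ltW.
  + by rewrite ltrDl.
- by move=> x x0; rewrite q0// min_r.
- by move=> x x2; rewrite min_l// q1// (le_trans d2).
- move=> x; have [x0|x0] := leP x 0.
    rewrite big1 ?le_min ?q_ge0 ?ler01// => i _.
    by rewrite q0 ?g_le0// min_r// mulr0.
  have [dx|xd] := leP d x.
    rewrite [leRHS]min_l ?q1// -[leRHS](average_cst 1).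
    by apply: ler_average => i; rewrite ge_min lexx.
  rewrite [leRHS]min_r ?q1' ?(ltW xd)//.
  have xr : 0 < x < r by rewrite x0 (lt_le_trans xd)// ge_min lexx.
  apply: (@le_trans _ _ (\sum_(i < N) p i * (expR (a * ln (k i)) * q x))).
    apply: ler_average => i; rewrite ge_min; apply/orP; right.
    apply: (le_trans (q_homo _ _ (g_lek _ _ xr))).
    rewrite {1}/q max_r; last by rewrite mulr_ge0// ltW.
    rewrite -mulrA powRM ?divr_ge0 ?(ltW x0) ?(ltW d_gt0) ?(ltW (k_gt0 i))//.
    by rewrite /q max_r ?(ltW x0)// {1}/powR gt_eqF.
  under eq_bigr do rewrite mulrA.
  by rewrite -mulr_suml ler_piMl.
Qed.

(** D need not be continuous, so its supremum M may not be attained. Instead of a maximum point, the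
    argument propagates a uniform gap below M from left to right: a gap e on (0, b] becomes a gap
    p_j e on (0, f_j b]. *)
Lemma max_principle g f (D : R -> R) (C : R) :
  (forall i, {homo g i : x y / x <= y}) ->
  (forall i, cancel (f i) (g i)) -> (forall i, cancel (g i) (f i)) ->
  (forall i (x : R), 0 < x < 1 -> 0 < g i x < 1) ->
  (forall x : R, 0 < x < 1 -> exists i, g i x < x) ->
  (forall x : R, 0 < x < 1 -> D x <= C) ->
  (forall x : R, 0 < x < 1 -> D x <= \sum_(i < N) p i * D (g i x)) ->
  (forall e : R, 0 < e -> exists2 d, 0 < d &
    forall x : R, 0 < x < 1 -> (x < d) || (1 - d < x) -> D x <= e) ->
  forall x : R, 0 < x < 1 -> D x <= 0.
Proof.
move=> g_homo fK gK g01 g_push DC D_sub D_bd x0 x001.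
rewrite leNgt; apply/negP => Dx0.
pose I01 := [set x : R | 0 < x < 1].
pose M := sup (D @` I01).
have supD : has_sup (D @` I01).
  split; first by exists (D x0), x0.
  by exists C => _ [x /= x01 <-]; exact: DC.
have DM x : 0 < x < 1 -> D x <= M.
  by move=> x01; apply: sup_upper_bound => //; exists x.
have M_gt0 : 0 < M by apply: lt_le_trans (DM _ x001).
have M2 : 0 < M / 2 by rewrite divr_gt0.
have [d d_gt0 dM] := D_bd _ M2.
(* Pushing the bound D <= M - e on (0, b] forward by f_j beyond a = sup S
   contradicts the choice of a. *)
pose S := [set x : R | 0 < x /\ exists2 e, 0 < e &
  forall y, 0 < y < 1 -> y <= x -> D y <= M - e].
(* Past 1 - d the boundary condition already gives the gap M/2. A gap e on (0, x] with x > 1 - d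
   would thus leave the gap min(e, M/2) on all of (0, 1), against the choice of M. *)
have S_le x : S x -> x <= 1 - d.
  move=> [x_gt0 [e e_gt0 xe]]; rewrite leNgt; apply/negP => dx.
  have e'0 : 0 < Num.min e (M / 2) by rewrite lt_min e_gt0.
  have [_ [y /= y01 <-]] := sup_adherent e'0 supD.
  rewrite -/M ltNge => /negP; apply; have [yx|xy] := leP y x.
    by apply: (le_trans (xe _ y01 yx)); rewrite lerD2l lerN2 ge_min lexx.
  apply: (@le_trans _ _ (M / 2)).
    by apply: dM => //; rewrite (lt_trans dx xy) orbT.
  have := @ge_min _ _ (M / 2) e (M / 2); rewrite lexx orbT; lra.
have Sd : S (d / 2).
  split; first by rewrite divr_gt0.
  exists (M / 2) => // y y01 yd; have -> : M - M / 2 = M / 2 by lra.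
  by apply: dM => //; apply/orP; left; lra.
have supS : has_ubound S by exists (1 - d) => x; exact: S_le.
pose a := sup S.
have a01 : 0 < a < 1.
  have : d / 2 <= a by apply: ub_le_sup.
  have : a <= 1 - d by apply: ge_sup; [exists (d / 2)|move=> x; exact: S_le].
  lra.
have [j gja] := g_push _ a01.
have [b Sb gjab] := sup_gt (ex_intro _ _ Sd) gja.
have [b_gt0 [e e_gt0 be]] := Sb.
have ba : b <= a by apply: ub_le_sup.
have ac : a < f j b.
  by rewrite ltNge; apply/negP => /(g_homo j); rewrite fK leNgt gjab.
suff /(ub_le_sup supS) : S (f j b) by rewrite leNgt ac.
split; first lra.
exists (p j * e); first by rewrite mulr_gt0.
move=> y y01 yfb; apply: (le_trans (D_sub _ y01)); apply: average_lt => [i|].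
  exact/DM/g01.
by apply: be; [exact: g01|rewrite -[leRHS](fK j); exact: g_homo].
Qed.

End backward_averaging.

(** * Harmonic functions by monotone iteration *)

Section harmonic.
Context (R : realType) (N : nat) (p : 'I_N -> R).
Hypothesis p_gt0 : forall i, 0 < p i.
Hypothesis p_sum : \sum_(i < N) p i = 1.
Context (g f : 'I_N -> R -> R).
Hypothesis g_homo : forall i, {homo g i : x y / x <= y}.
Hypothesis f_lt : forall i, {homo f i : x y / x < y}.
Hypothesis fK : forall i, cancel (f i) (g i).
Hypothesis gK : forall i, cancel (g i) (f i).

Definition average (H : R -> R) (x : R) : R := \sum_(i < N) p i * H (g i x).

Lemma average_homo H : {homo H : x y / x <= y} -> {homo average H : x y / x <= y}.
Proof. by move=> Hh x y xy; apply: ler_average => // i; exact/Hh/g_homo. Qed.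

Lemma average_right_approx H : {homo H : x y / x <= y} -> right_approx _ H ->
  right_approx _ (average H).
Proof.
move=> Hh Hr x e e_gt0.
have /(_ _)/cid2-/all_sig2[z gz Hz] i := Hr (g i x) _ e_gt0.
(* Each f_i (z_i) lies to the right of x, and there are finitely many. The initial value [x + 1]
   only has to exceed x. *)
pose y := \big[Num.min/x + 1]_(i < N) f i (z i).
exists y.
  rewrite /y; elim/big_ind: _ => [|a b xa xb|i _]; rewrite ?ltrDl//.
    by rewrite lt_min xa.
  by rewrite -[ltLHS](gK i) f_lt.
have -> : average H x + e = \sum_(i < N) p i * (H (g i x) + e).
  by under eq_bigr do rewrite mulrDr; rewrite big_split/= average_cst.
apply: ler_average => // i; apply: (le_trans _ (Hz i)).
apply: Hh; rewrite -[leRHS](fK i); apply: g_homo.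
exact: bigmin_le_cond.
Qed.

Context (H K : R -> R).
Hypothesis H_homo : {homo H : x y / x <= y}.
Hypothesis H_right : right_approx _ H.
Hypothesis H_super : forall x, average H x <= H x.
Hypothesis K_sub : forall x, K x <= average K x.
Hypothesis KH : forall x, K x <= H x.

(** The iterates of the averaging operator on H decrease and stay above K; their pointwise limit is
    harmonic because a finite average commutes with limits. *)
Lemma harmonic_between : exists F : R -> R, [/\ {homo F : x y / x <= y},
  right_approx _ F, (forall x, F x = average F x) &
  forall x, K x <= F x <= H x].
Proof.
pose u n := iter n average H.
have u_homo n : {homo u n : x y / x <= y} by elim: n => //= n; exact: average_homo.
have u_right n : right_approx _ (u n).
  by elim: n => //= n; exact: average_right_approx.
have u_le n x : u n.+1 x <= u n x.
  elim: n x => [|n IH] x; first exact: H_super.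
  by apply: ler_average => // i; exact: IH.
have u_dec x : nonincreasing_seq (u ^~ x).
  by apply/nonincreasing_seqP => n; exact: u_le.
have Ku n x : K x <= u n x.
  elim: n x => [|n IH] x; first exact: KH.
  by apply: (le_trans (K_sub x)); apply: ler_average => // i; exact: IH.
have cu x : cvgn (u ^~ x).
  apply: nonincreasing_is_cvgn => //.
  by exists (K x) => _ [n _ <-]; exact: Ku.
pose F x := limn (u ^~ x).
have F_le n x : F x <= u n x by exact: nonincreasing_cvgn_ge.
exists F; split.
- by move=> x y xy; apply: ler_lim => //; apply: nearW => n; exact: u_homo.
(* Right continuity survives a decreasing limit: choose n with u_n(x) < F(x) + e/2, then y > x with
   u_n(y) <= u_n(x) + e/2, and use F(y) <= u_n(y). *)
- move=> x e e_gt0.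
  have e2 : 0 < e / 2 by rewrite divr_gt0.
  have /cvgrPdist_lt/(_ _ e2)[n _ /(_ n)/= hn] := cu x.
  have [y xy uy] := u_right n x _ e2; exists y => //.
  have := hn (leqnn n); rewrite ltr_distlC => /andP[_ h].
  have := F_le n y; rewrite -/(F x) in h; lra.
- move=> x; apply: (@cvg_unique _ (@Rhausdorff R) (u n.+1 x @[n --> \oo])).
    by have := cu x; rewrite -(cvg_shiftS (u ^~ x)).
  apply: cvg_big => [|i _]; [exact: add_continuous|apply: cvgMl_tmp; exact: cu].
- move=> x; rewrite (F_le 0)/= andbT; apply: limr_ge => //.
  by apply: nearW => n; exact: Ku.
Qed.

End harmonic.

(** * Probability measures and distribution functions *)

Lemma right_approx_right_continuous (R : realType) (F : R -> R) (x : R) :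
  {homo F : x y / x <= y} -> right_approx _ F -> F @ x^'+ --> F x.
Proof.
move=> F_homo F_right; apply/cvgrPdist_le => e e_gt0.
have [y xy Fy] := F_right x e e_gt0.
near=> z.
have xz : x <= z by near: z; exact: nbhs_right_ge.
have zy : z <= y by near: z; exact: nbhs_right_le.
rewrite ler_distlC; have := F_homo _ _ xz; have := F_homo _ _ zy; lra.
Unshelve. all: by end_near. Qed.

Section distribution_functions.
Context (R : realType).

Lemma probability_of_cdf (F : R -> R) : {homo F : x y / x <= y} ->
  right_approx _ F -> (forall x, x <= 0 -> F x = 0) -> (forall x, 1 <= x -> F x = 1) ->
  exists mu : probability (measurableTypeR R) R, forall x, mu `]-oo, x]%classic = (F x)%:E.
Proof.
move=> F_homo F_right F0 F1.
have FNy : F @ -oo --> (0 : R).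
  apply: cvg_near_cst; near=> x; apply: F0; near: x; exact: nbhs_ninfty_le.
have Fy : F @ +oo --> (1 : R).
  apply: cvg_near_cst; near=> x; apply: F1; near: x; exact: nbhs_pinfty_ge.
pose Fc := HB.pack_for (cumulativeBounded (0 : R) (1 : R)) F
  (isCumulative.Build R _ R F F_homo
     (fun x => right_approx_right_continuous _ _ x F_homo F_right))
  (isCumulativeBounded.Build R 0 1 F FNy Fy).
exists (lebesgue_stieltjes_measure Fc) => x.
by rewrite -(cdf_lebesgue_stieltjes_id Fc x).
Unshelve. all: by end_near. Qed.

(** The closed left half-lines are stable under intersection, generate the Borel sets and exhaust
    the line, so uniqueness on a generating pi-system applies. *)
Lemma eq_measure_cdf (m1 m2 : {measure set (measurableTypeR R) -> \bar R}) :
  (m1 setT < +oo)%E ->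
  (forall x : R, m1 `]-oo, x]%classic = m2 `]-oo, x]%classic) ->
  forall A, measurable A -> m1 A = m2 A.
Proof.
move=> m1_fin m12.
move=> A; apply: (@measure_unique _ R (measurableTypeR R) [set `]-oo, x]%classic | x in [set: R]]
  (fun n => `]-oo, n%:R]%classic)).
(* Borel sets are generated here by the intervals ]a, b], each of which is a difference of two
   half-lines. *)
- rewrite eqEsubset; split => B.
    apply: smallest_sub; first exact: smallest_sigma_algebra.
    move=> _ [[a b] _ <-] /=.
    have -> : `]a, b]%classic = `]-oo, b] `\` `]-oo, a].
      by rewrite -[RHS]setCK setCD setCitvl setUC -[LHS]setCK setCitv.
    apply: (@measurableD _ (g_sigma_algebraType [set `]-oo, x]%classic | x in [set: R]]));
      by apply: sub_sigma_algebra; eexists.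
  apply: smallest_sub; first exact: smallest_sigma_algebra.
  by move=> _ [x _ <-]; exact: measurable_itv.
- move=> _ _ [x _ <-] [y _ <-]; exists (Num.min x y) => //.
  apply/seteqP; split => z /=; rewrite !in_itv/= le_min.
    by move=> /andP[].
  by move=> [-> ->].
- by move=> n; exists n%:R.
- rewrite -subTset => x _; exists (Num.truncn x).+1 => //=.
  by rewrite in_itv/= ltW// truncnS_gt.
- by move=> _ [x _ <-]; exact: m12.
- move=> n; apply: le_lt_trans m1_fin; apply: le_measure; rewrite ?inE//.
Qed.

End distribution_functions.

(** * Measures concentrated on the open interval *)

Section concentrated.
Context (R : realType) (nu : probability (measurableTypeR R) R).
Hypothesis nu01 : nu (~` `]0, 1[%classic) = 0%E.

Lemma measure_setI01 (A : set (measurableTypeR R)) : measurable A ->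
  nu (A `&` `]0, 1[%classic) = nu A.
Proof.
move=> mA; rewrite [RHS](measureDI _ mA (measurable_itv `]0, 1[)).
rewrite [X in (X + _)%E](_ : _ = 0%E) ?add0e//.
apply/eqP; rewrite eq_le measure_ge0 andbT -nu01 le_measure ?inE//.
- by apply: measurableD => //; exact: measurable_itv.
- by apply: measurableC; exact: measurable_itv.
Qed.

(** Continuity from below along compact intervals exhausting (0, 1). It supplies the boundary
    condition of [max_principle]. *)
Lemma concentrated_tight (e : R) : 0 < e ->
  exists2 d : R, 0 < d & (nu (~` `[d, (1 - d)%R]%classic) <= e%:E)%E.
Proof.
move=> e_gt0.
pose F n : set R := `[n.+1%:R^-1, 1 - n.+1%:R^-1]%classic.
have F01 : \bigcup_n F n = `]0, 1[%classic.
  apply/seteqP; split => x.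
    move=> [n _]; rewrite /F /= !in_itv/=.
    have : (0 : R) < n.+1%:R^-1 by rewrite invr_gt0.
    by move: (n.+1%:R^-1 : R) => u; lra.
  rewrite /= in_itv/= => /andP[x0 x1].
  pose m := Num.min x (1 - x).
  have m_gt0 : 0 < m by rewrite lt_min x0 subr_gt0.
  exists (Num.truncn m^-1) => //.
  have : (Num.truncn m^-1).+1%:R^-1 < m.
    by rewrite -[ltRHS]invrK ltf_pV2 ?posrE ?invr_gt0// truncnS_gt.
  by rewrite lt_min /F /= in_itv/=; move: (_.+1%:R^-1 : R) => u; lra.
have F_sub n m : (n <= m)%N -> F n `<=` F m.
  move=> nm x; rewrite /F /= !in_itv/=.
  have : (m.+1%:R^-1 : R) <= n.+1%:R^-1 by rewrite lef_pV2 ?posrE// ler_nat.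
  by move: (m.+1%:R^-1 : R) (n.+1%:R^-1 : R) => u v; lra.
have : nu (F n) @[n --> \oo] --> nu (\bigcup_n F n).
  apply: nondecreasing_cvg_mu.
  - by move=> n; exact: measurable_itv.
  - by apply: bigcup_measurable => n _; exact: measurable_itv.
  - by move=> n m nm; apply/subsetPset; exact: F_sub.
have -> : nu (\bigcup_n F n) = 1%:E.
  by rewrite F01 -[RHS](probability_setT nu) -[RHS]measure_setI01 ?setTI.
move=> /fine_cvgP[_] /cvgrPdist_le/(_ _ e_gt0)[n _ /(_ n (leqnn n))/=].
move=> Fne; exists n.+1%:R^-1; first by rewrite invr_gt0.
have mF : measurable (F n : set (measurableTypeR R)) by exact: measurable_itv.
rewrite -/(F n) probability_setC// -[nu (F n)]fineK ?fin_num_measure//.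
by rewrite -EFinB lee_fin (le_trans _ Fne)// ler_norm.
Qed.

End concentrated.

(** * Uniqueness and absence of atoms *)

Section invariant_measures.
Context (R : realType) (N : nat) (p : 'I_N -> R).
Hypothesis p_gt0 : forall i, 0 < p i.
Hypothesis p_sum : \sum_(i < N) p i = 1.
Context (g f : 'I_N -> R -> R).
Hypothesis g_lt : forall i, {homo g i : x y / x < y}.
Hypothesis f_lt : forall i, {homo f i : x y / x < y}.
Hypothesis fK : forall i, cancel (f i) (g i).
Hypothesis gK : forall i, cancel (g i) (f i).
Hypothesis g01 : forall i x, 0 < x < 1 -> 0 < g i x < 1.
Hypothesis g_push : forall x, 0 < x < 1 -> exists i, g i x < x.

(** Unlike in [markov_op], preimages are not cut down to [0, 1]: the maps are bijections of the
    whole line, as [extend01] provides. *)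
Definition stationary (nu : set R -> \bar R) :=
  forall A : set (measurableTypeR R), measurable A ->
  (\sum_(i < N) (p i)%:E * nu (f i @^-1` A))%E = nu A.

Lemma preimage_measurable i (A : set (measurableTypeR R)) :
  measurable A -> measurable (f i @^-1` A : set (measurableTypeR R)).
Proof.
move=> mA; rewrite -[X in measurable X]setTI.
have : measurable_fun [set: measurableTypeR R] (f i : measurableTypeR R -> measurableTypeR R).
  by apply: nondecreasing_measurable => // x y; rewrite le_eqVlt => /predU1P[->//|/f_lt/ltW].
exact.
Qed.

(** This turns the Markov operator on measures into averaging of distribution functions over the
    [g i]. *)
Lemma preimage_itvNyc i x : f i @^-1` `]-oo, x] = `]-oo, g i x]%classic.
Proof.
apply/seteqP; split => y /=; rewrite !in_itv/=.
  by move=> fyx; rewrite leNgt; apply/negP => /(f_lt i); rewrite gK ltNge fyx.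
by move=> ygx; rewrite leNgt; apply/negP => /(g_lt i); rewrite fK ltNge ygx.
Qed.

Lemma preimage_set1 i x : f i @^-1` [set x] = [set g i x].
Proof. by apply/seteqP; split => y /= => [<-|->]; rewrite ?fK ?gK. Qed.

Lemma invariant_fine (nu : probability (measurableTypeR R) R) (A : set (measurableTypeR R)) :
  stationary nu -> measurable A ->
  fine (nu A) = \sum_(i < N) p i * fine (nu (f i @^-1` A)).
Proof.
move=> nu_inv mA; rewrite -(nu_inv _ mA) -sum_fine.
  by apply: eq_bigr => i _; rewrite fineM// fin_num_measure//; exact: preimage_measurable.
by move=> i _; rewrite fin_numM// fin_num_measure//; exact: preimage_measurable.
Qed.

(** The weighted sum of the image measures is built as a measure, so that it can be compared with
    [nu] through distribution functions alone. *)
Lemma invariant_of_cdf (nu : probability (measurableTypeR R) R) (F : R -> R) :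
  (forall x, nu `]-oo, x]%classic = (F x)%:E) ->
  (forall x, F x = \sum_(i < N) p i * F (g i x)) -> stationary nu.
Proof.
move=> nuF Fg.
pose q i := NngNum (ltW (p_gt0 i)).
have mf i : measurable_fun [set: measurableTypeR R] (f i : measurableTypeR R -> measurableTypeR R).
  by move=> _ A mA; rewrite setTI; exact: preimage_measurable.
pose X i : {mfun measurableTypeR R >-> measurableTypeR R} :=
  @mfun_Sub _ _ (measurableTypeR R) (measurableTypeR R) (f i) (mem_set (mf i)).
pose mi i : {measure set (measurableTypeR R) -> \bar R} := mscale (q i) (distribution nu (X i)).
pose m0 : {measure set (measurableTypeR R) -> \bar R} := mzero.
(* [msum] adds a sequence indexed by the naturals, so the family over 'I_N is continued by the zero
   measure. *)
pose m k := if insub k is Some i then mi i else m0.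
have mE A : msum m N A = (\sum_(i < N) (p i)%:E * nu (f i @^-1` A))%E.
  by apply: eq_bigr => i _; rewrite /m valK.
have m_cdf x : msum m N `]-oo, x]%classic = nu `]-oo, x]%classic.
  rewrite mE nuF Fg -sumEFin; apply: eq_bigr => i _.
  by rewrite preimage_itvNyc nuF.
move=> A mA; rewrite -mE; apply/esym.
apply: (eq_measure_cdf _ nu (msum m N)) => // [|x]; last exact/esym/m_cdf.
exact: le_lt_trans (probability_le1 nu _) (ltry _).
Qed.

Let g_homo i : {homo g i : x y / x <= y}.
Proof. by move=> x y; rewrite le_eqVlt => /predU1P[->//|/g_lt/ltW]. Qed.

(** The absolute difference of the two distribution functions is subharmonic by the triangle
    inequality, and tightness makes it small near both endpoints. *)
Lemma invariant_unique (mu nu : probability (measurableTypeR R) R) :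
  mu (~` `]0, 1[%classic) = 0%E -> nu (~` `]0, 1[%classic) = 0%E ->
  stationary mu -> stationary nu ->
  forall A : set (measurableTypeR R), measurable A -> mu A = nu A.
Proof.
move=> mu01 nu01 mu_inv nu_inv.
have mI x : measurable (`]-oo, x]%classic : set (measurableTypeR R)) by exact: measurable_itv.
suff cdfE x : mu `]-oo, x]%classic = nu `]-oo, x]%classic.
  apply: eq_measure_cdf => [|x]; last exact: cdfE.
  exact: le_lt_trans (probability_le1 mu _) (ltry _).
(* Outside (0, 1) both distribution functions are 0 or both are 1; the maximum principle handles the
   rest. *)
have [x0|x0] := leP x 0.
  by rewrite -(measure_setI01 _ _ mu01)// -(measure_setI01 _ _ nu01)//
    (_ : _ `&` _ = set0) ?measure0//; apply/seteqP; split => y //=; rewrite !in_itv/=; lra.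
have [x1|x1] := leP 1 x.
  rewrite -(measure_setI01 _ _ mu01)// -(measure_setI01 _ _ nu01)//.
  rewrite (_ : _ `&` _ = setT `&` `]0, 1[%classic); last first.
    by apply/seteqP; split => y /=; rewrite !in_itv/=; lra.
  by rewrite !measure_setI01// !probability_setT.
pose D x := `|fine (mu `]-oo, x]%classic) - fine (nu `]-oo, x]%classic)|.
suff : D x <= 0.
  rewrite normr_le0 subr_eq0 => /eqP eqx.
  by rewrite -[LHS]fineK ?fin_num_measure// eqx fineK// fin_num_measure.
have small (m : probability (measurableTypeR R) R) (e d y : R) :
    (m (~` `[d, (1 - d)%R]%classic) <= e%:E)%E -> y < d -> 0 <= fine (m `]-oo, y]%classic) <= e.
  move=> me yd; rewrite fine_ge0//= -lee_fin fineK ?fin_num_measure//.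
  apply: (le_trans _ me); apply: le_measure; rewrite ?inE//.
    by apply: measurableC; exact: measurable_itv.
  by move=> z /=; rewrite !in_itv/= => zy /andP[]; lra.
have large (m : probability (measurableTypeR R) R) (e d y : R) :
    (m (~` `[d, (1 - d)%R]%classic) <= e%:E)%E -> 1 - d < y -> 1 - e <= fine (m `]-oo, y]%classic) <= 1.
  move=> me yd.
  have -> : fine (m `]-oo, y]%classic) = 1 - fine (m (~` `]-oo, y]%classic)).
    by rewrite probability_setC// -[m _]fineK ?fin_num_measure//= opprB addrCA subrr addr0.
  rewrite lerD2l lerN2 gerDl oppr_le0 fine_ge0// andbT.
  rewrite -lee_fin fineK ?fin_num_measure//; last exact: measurableC.
  apply: (le_trans _ me); apply: le_measure; rewrite ?inE//.
  - exact: measurableC.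
  - by apply: measurableC; exact: measurable_itv.
  - by move=> z /=; rewrite !in_itv/= => zy /andP[]; lra.
apply: (max_principle _ _ _ p_gt0 p_sum g f D 1) => //.
- move=> y _; rewrite /D ler_norml.
  have := probability_le1 mu (mI y); have := probability_le1 nu (mI y).
  rewrite -[mu _]fineK ?fin_num_measure// -[nu _]fineK ?fin_num_measure// !lee_fin.
  have : 0 <= fine (mu `]-oo, y]%classic) by exact: fine_ge0.
  have : 0 <= fine (nu `]-oo, y]%classic) by exact: fine_ge0.
  lra.
- move=> y _; rewrite /D !(invariant_fine _ `]-oo, y]%classic)// -sumrB.
  apply: (le_trans (ler_norm_sum _ _ _)); apply: ler_sum => i _.
  by rewrite -mulrBr normrM gtr0_norm// preimage_itvNyc.
- move=> e e_gt0.
  have [d1 d1_gt0 mu_d1] := concentrated_tight _ _ mu01 _ e_gt0.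
  have [d2 d2_gt0 nu_d2] := concentrated_tight _ _ nu01 _ e_gt0.
  exists (Num.min d1 d2); first by rewrite lt_min d1_gt0.
  move=> y _ /orP[|].
    rewrite lt_min => /andP[/(small _ _ _ _ mu_d1) h1 /(small _ _ _ _ nu_d2) h2].
    by rewrite /D ler_norml; lra.
  rewrite ltrBlDr -ltrBlDl lt_min => /andP[y1 y2].
  have := large _ _ _ y mu_d1; have := large _ _ _ y nu_d2.
  by rewrite /D ler_norml; lra.
- by rewrite x0.
Qed.

(** The point mass at x is the average of the point masses at the g_i x, and near the endpoints it
    is bounded by the mass outside a compact interval. *)
Lemma invariant_atomless (mu : probability (measurableTypeR R) R) :
  mu (~` `]0, 1[%classic) = 0%E -> stationary mu ->
  forall x, 0 < x < 1 -> mu [set x] = 0%E.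
Proof.
move=> mu01 mu_inv x x01.
have m1 y : measurable ([set y] : set (measurableTypeR R)) by exact: measurable_set1.
rewrite -[LHS]fineK ?fin_num_measure//; congr EFin; apply/eqP.
rewrite eq_le fine_ge0// andbT.
apply: (max_principle _ _ _ p_gt0 p_sum g f (fun x => fine (mu [set x])) 1) => //.
- move=> y _; rewrite -lee_fin fineK ?fin_num_measure//; exact: probability_le1.
- move=> y _; rewrite (invariant_fine _ [set y])//.
  by apply: ler_sum => i _; rewrite preimage_set1.
- move=> e e_gt0.
  have [d d_gt0 mu_d] := concentrated_tight _ _ mu01 _ e_gt0.
  exists d => // y _ yd; rewrite -lee_fin fineK ?fin_num_measure//.
  apply: (le_trans _ mu_d); apply: le_measure; rewrite ?inE//.
    by apply: measurableC; exact: measurable_itv.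
  by move=> z /= ->; rewrite in_itv/= => /andP[]; move: yd => /orP[]; lra.
Qed.

End invariant_measures.

(** * Extension to the line, and derivatives at the endpoints *)

Section extension.
Context (R : realType).
Implicit Types (f g : R -> R).

(* Extension by the identity: it makes the preimage of a subset of [0, 1] a
   subset of [0, 1], and keeps the maps bijective on R. *)
Definition extend01 f (x : R) : R := if x \in `[0, 1] then f x else x.

Lemma extend01_lt f : set_fun `[0, 1] `[0, 1] f ->
  {in `[0, 1] &, {homo f : x y / x < y}} -> {homo extend01 f : x y / x < y}.
Proof.
move=> f01 f_lt x y xy; rewrite /extend01.
have [x01|x01] := boolP (x \in `[0, 1]); have [y01|y01] := boolP (y \in `[0, 1]) => //.
- exact: f_lt.
- have := f01 _ x01; rewrite /= !in_itv/= in x01 y01 *.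
  by move: y01; rewrite negb_and -!ltNge; lra.
- have := f01 _ y01; rewrite /= !in_itv/= in x01 y01 *.
  by move: x01; rewrite negb_and -!ltNge; lra.
Qed.

Lemma extend01K f g : set_fun `[0, 1] `[0, 1] f ->
  {in `[0, 1], cancel f g} -> cancel (extend01 f) (extend01 g).
Proof.
move=> f01 fK x; rewrite /extend01.
have [x01|x01] := boolP (x \in `[0, 1]); last by rewrite (negbTE x01).
by rewrite (f01 _ x01 : f x \in `[0, 1]) fK.
Qed.

Lemma extend01_preimage f (A : set R) : set_fun `[0, 1] `[0, 1] f ->
  A `<=` `[0, 1] -> extend01 f @^-1` A = `[0, 1] `&` f @^-1` A.
Proof.
move=> f01 A01; apply/seteqP; split => x; rewrite /= /extend01.
  by have [x01 //|x01 /A01] := boolP (x \in `[0, 1]); rewrite /= (negbTE x01).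
by move=> [x01 fx]; rewrite [_ \in _]x01.
Qed.

Lemma extend01_fix f g : set_fun `[0, 1] `[0, 1] f -> set_fun `[0, 1] `[0, 1] g ->
  {in `[0, 1], cancel g f} -> {in `[0, 1] &, {homo f : x y / x < y}} ->
  f 0 = 0 /\ f 1 = 1.
Proof.
move=> f01 g01 gK f_lt.
have i0 : 0 \in `[0 : R, 1] by rewrite in_itv/= lexx ler01.
have i1 : 1 \in `[0 : R, 1] by rewrite in_itv/= lexx ler01.
have f_le : {in `[0, 1] &, {homo f : x y / x <= y}}.
  by move=> x y x01 y01; rewrite le_eqVlt => /predU1P[->//|/f_lt/ltW]; exact.
have f0 : 0 <= f 0 by have := f01 _ i0; rewrite /= in_itv/= => /andP[].
have f1 : f 1 <= 1 by have := f01 _ i1; rewrite /= in_itv/= => /andP[].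
have g0 := g01 _ i0; have g1 := g01 _ i1.
split; apply/eqP; rewrite eq_le ?f0 ?f1 ?andbT /=.
  rewrite -[leRHS](gK 0)//; apply: f_le => //.
  by move: g0; rewrite /= in_itv/= => /andP[].
rewrite -[leLHS](gK 1)//; apply: f_le => //.
by move: g1; rewrite /= in_itv/= => /andP[].
Qed.

Lemma deriv01_gt f (a c : R) : derivable01 f a -> c < deriv01 f a ->
  exists2 r, 0 < r & forall y, 0 <= y <= 1 -> y != a -> `|y - a| < r ->
    c < (f y - f a) / (y - a).
Proof.
move=> df cd.
have := cvgr_gt _ df _ cd.
rewrite /dnbhs !near_withinE => /(_ _)/nbhs_ballP[r /= r_gt0 ball_r]; exists r => //.
move=> y y01 ya yar; apply: ball_r => //.
by rewrite /ball /= distrC.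
Qed.

End extension.

(** * From a positive Lyapunov exponent to a barrier *)

Section drift.
Context (R : realType) (N : nat) (p : 'I_N -> R).
Hypothesis p_gt0 : forall i, 0 < p i.
Hypothesis p_sum : \sum_(i < N) p i = 1.
Context (g f : 'I_N -> R -> R) (d : 'I_N -> R).
Hypothesis g_lt : forall i, {homo g i : x y / x < y}.
Hypothesis f_lt : forall i, {homo f i : x y / x < y}.
Hypothesis fK : forall i, cancel (f i) (g i).
Hypothesis gK : forall i, cancel (g i) (f i).
Hypothesis f0 : forall i, f i 0 = 0.
Hypothesis d_gt0 : forall i, 0 < d i.
Hypothesis drift : 0 < \sum_(i < N) p i * ln (d i).
Hypothesis f_ge : forall i (c : R), c < d i ->
  exists2 r, 0 < r & forall x, 0 < x < r -> c * x <= f i x.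

(** A lower bound f_i(x) >= c_i x near 0 means g_i(x) <= x / c_i, which is the input of
    [power_barrier]. The numbers [d i] stand for derivatives at either endpoint, the endpoint 1
    being reached by reflection. *)
Lemma expansion_barrier :
  exists H : R -> R, [/\ {homo H : x y / x <= y}, right_approx _ H,
    (forall x : R, x <= 0 -> H x = 0), (forall x : R, 2^-1 <= x -> H x = 1) &
    (forall x, \sum_(i < N) p i * H (g i x) <= H x)].
Proof.
have g0 i : g i 0 = 0 by rewrite -{1}(f0 i) fK.
pose s := \sum_(i < N) p i * ln (d i).
have s_gt0 : 0 < s by exact: drift.
(* Lowering every logarithm by s/2 leaves strict room below [d i], while the drift of the inverse
   slopes is still s/2 - s < 0. *)
pose c i := d i * expR (- (s / 2)).
have c_gt0 i : 0 < c i by rewrite mulr_gt0 ?expR_gt0.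
have c_lt i : c i < d i.
  by rewrite gtr_pMr// -expR0 ltr_expR oppr_lt0 divr_gt0.
have /(_ _)/cid2-/all_sig2[r r_gt0 fr] i := f_ge i _ (c_lt i).
have gc i x : 0 < x < f i (r i) -> g i x <= (c i)^-1 * x.
  move=> /andP[x0 xr]; rewrite mulrC ler_pdivlMr// mulrC -[leRHS](gK i); apply: fr.
  by apply/andP; split; [rewrite -(g0 i) g_lt|rewrite -[ltRHS](fK i) g_lt].
(* The lower bound on f_i is applied at g_i x, which must stay below r_i; hence the images f_i (r_i)
   under the minimum. *)
pose r' := \big[Num.min/1]_(i < N) f i (r i).
have r'_gt0 : 0 < r'.
  rewrite /r'; elim/big_ind: _ => [//|a b a0 b0|i _]; first by rewrite lt_min a0.
  by rewrite -(f0 i) f_lt.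
apply: (power_barrier _ _ _ p_gt0 p_sum g (fun i => (c i)^-1) r') => //.
- by move=> i; rewrite invr_gt0.
- have -> : \sum_(i < N) p i * ln (c i)^-1 = \sum_(i < N) (p i * (s / 2) - p i * ln (d i)).
    apply: eq_bigr => i _; rewrite lnV ?posrE// lnM ?posrE ?expR_gt0// expRK; ring.
  by rewrite sumrB average_cst// -/s; lra.
- move=> i x; rewrite le_eqVlt => /predU1P[->|x0]; first by rewrite g0.
  by apply: ltW; rewrite -(g0 i) g_lt.
- move=> i x /andP[x0 xr]; apply: gc; rewrite x0 (lt_le_trans xr)//.
  exact: bigmin_le_cond.
Qed.

End drift.

(** The arguments on measures use a single null set, the complement of the open interval; it is the
    union of the two null sets of [in_M1_open01]. *)
Lemma in_M1_open01P (R : realType) (nu : probability (measurableTypeR R) R) :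
  in_M1_open01 nu <-> nu (~` `]0, 1[%classic) = 0%E.
Proof.
have m01 : measurable (~` `[0, 1]%classic : set (measurableTypeR R)).
  by apply: measurableC; exact: measurable_itv.
have m2 : measurable ([set 0; 1] : set (measurableTypeR R)).
  by apply: measurableU; exact: measurable_set1.
have mo : measurable (~` `]0, 1[%classic : set (measurableTypeR R)).
  by apply: measurableC; exact: measurable_itv.
have le0 (A B : set (measurableTypeR R)) : measurable A -> measurable B ->
    A `<=` B -> nu B = 0%E -> nu A = 0%E.
  move=> mA mB AB B0; apply/eqP; rewrite eq_le measure_ge0 andbT -B0.
  by rewrite le_measure ?inE.
split=> [[h1 h2]|h]; last first.
  split; apply: (le0 _ _ _ _ _ h) => // x /=; rewrite !in_itv/=.
    by move=> + /andP[x0 x1]; apply; rewrite !ltW.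
  by move=> [->|->]; rewrite ltxx ?andbF.
apply: (le0 _ (~` `[0, 1]%classic `|` [set 0; 1])) => //.
- exact: measurableU.
- move=> x /= /negP; rewrite !in_itv/= negb_and -!leNgt => x01.
  have [x0|x0] := eqVneq x 0; first by right; left.
  have [x1|x1] := eqVneq x 1; first by right; right.
  left => /andP[x0' x1']; move: x01.
  by rewrite !leNgt !lt_neqAle x0' x1' eq_sym x0 x1.
- apply/eqP; rewrite eq_le measure_ge0 andbT.
  suff <- : (nu (~` `[0%R, 1%R]%classic) + nu [set 0%R; 1%R] = 0)%E by exact: measureU2.
  by rewrite h1 h2 adde0.
Qed.

(** * Existence of an invariant measure *)

Section existence.
Context (R : realType) (N : nat) (p : 'I_N -> R).
Hypothesis p_gt0 : forall i, 0 < p i.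
Hypothesis p_sum : \sum_(i < N) p i = 1.
Context (g f : 'I_N -> R -> R) (d0 d1 : 'I_N -> R).
Hypothesis g_lt : forall i, {homo g i : x y / x < y}.
Hypothesis f_lt : forall i, {homo f i : x y / x < y}.
Hypothesis fK : forall i, cancel (f i) (g i).
Hypothesis gK : forall i, cancel (g i) (f i).
Hypothesis f0 : forall i, f i 0 = 0.
Hypothesis f1 : forall i, f i 1 = 1.
Hypothesis d0_gt0 : forall i, 0 < d0 i.
Hypothesis drift0 : 0 < \sum_(i < N) p i * ln (d0 i).
Hypothesis f_ge0 : forall i (c : R), c < d0 i ->
  exists2 r, 0 < r & forall x, 0 < x < r -> c * x <= f i x.
Hypothesis d1_gt0 : forall i, 0 < d1 i.
Hypothesis drift1 : 0 < \sum_(i < N) p i * ln (d1 i).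
Hypothesis f_ge1 : forall i (c : R), c < d1 i ->
  exists2 r, 0 < r & forall x, 0 < x < r -> c * x <= 1 - f i (1 - x).

(** The last clause prevents mass at 1; at 0 the same follows from F(0) = 0. *)
Lemma harmonic_cdf : exists F : R -> R, [/\ {homo F : x y / x <= y},
  right_approx _ F, (forall x, F x = \sum_(i < N) p i * F (g i x)),
  (forall x, x <= 0 -> F x = 0) /\ (forall x, 1 <= x -> F x = 1) &
  (forall e, 0 < e -> exists2 x, x < 1 & 1 - e <= F x)].
Proof.
have [H [H_homo H_right H0 H1 H_super]] :=
  (* Conjugation by x -> 1 - x moves the endpoint 1 to 0. *)
  expansion_barrier _ _ _ p_gt0 p_sum g f d0 g_lt f_lt fK gK f0 d0_gt0 drift0 f_ge0.
have [|||||H' [H'_homo H'_right H'0 H'1 H'_super]] :=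
  expansion_barrier _ _ _ p_gt0 p_sum (fun i x => 1 - g i (1 - x))
    (fun i x => 1 - f i (1 - x)) d1 _ _ _ _ _ d1_gt0 drift1 f_ge1.
- by move=> i x y xy; rewrite ltrD2l ltrN2 g_lt// ltrD2l ltrN2.
- by move=> i x y xy; rewrite ltrD2l ltrN2 f_lt// ltrD2l ltrN2.
- by move=> i x; rewrite subKr fK subKr.
- by move=> i x; rewrite subKr gK subKr.
- by move=> i; rewrite subr0 f1 subrr.
pose K x := 1 - H' (1 - x).
have nneg G : {homo G : x y / x <= y} -> (forall x : R, x <= 0 -> G x = 0) ->
    forall x, (0 : R) <= G x.
  move=> G_homo G0 x; rewrite -(G0 (Num.min x 0)) ?ge_min ?lexx ?orbT//.
  by apply: G_homo; rewrite ge_min lexx.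
have K_sub x : K x <= average _ _ p g K x.
  rewrite /average /K; under eq_bigr do rewrite mulrBr mulr1.
  rewrite sumrB p_sum lerD2l lerN2; apply: le_trans (H'_super (1 - x)).
  by apply: ler_sum => i _; rewrite subKr.
(* To the right of 1/2 the upper barrier is 1, to the left of it the lower one is 0. *)
have KH x : K x <= H x.
  have [x2|x2] := leP (2^-1) x.
    by rewrite H1// gerBl nneg.
  by rewrite /K H'1 ?subrr ?nneg//; lra.
have [|F [F_homo F_right FE KFH]] := harmonic_between _ _ _ p_gt0 p_sum g f _ f_lt fK gK
  H K H_homo H_right H_super K_sub KH.
  by move=> i x y; rewrite le_eqVlt => /predU1P[->//|/g_lt/ltW].
exists F; split => //.
  split => x x0; apply/eqP; rewrite eq_le; have /andP[KF FH] := KFH x.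
    rewrite -{1}(H0 x x0) FH/=; apply: le_trans KF; rewrite /K H'1 ?subrr//; lra.
  rewrite -{1}(H1 x) ?FH/=; last by lra.
  by apply: le_trans KF; rewrite /K H'0 ?subr0//; lra.
(* F dominates K, and K is close to 1 near 1 because H' is right continuous at 0 with value 0. *)
move=> e e_gt0; have [y y0 H'y] := H'_right 0 e e_gt0.
exists (1 - y); first by rewrite gtrBl.
have /andP[+ _] := KFH (1 - y); apply: le_trans.
by rewrite /K subKr lerD2l lerN2; move: H'y; rewrite (H'0 0)// add0r.
Qed.

Lemma invariant_exists : exists2 mu : probability (measurableTypeR R) R,
  mu (~` `]0, 1[%classic) = 0%E & stationary _ _ p f mu.
Proof.
have [F [F_homo F_right FE [F0 F1] F_large]] := harmonic_cdf.
have [mu muF] := probability_of_cdf _ _ F_homo F_right F0 F1.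
exists mu; last exact: (invariant_of_cdf _ _ _ p_gt0 g f g_lt f_lt fK gK mu F).
apply/eqP; rewrite eq_le measure_ge0 andbT; apply/lee_addgt0Pr => e e_gt0.
rewrite add0e; have [x x1 Fx] := F_large e e_gt0.
have mI y : measurable (`]-oo, y]%classic : set (measurableTypeR R)) by exact: measurable_itv.
(* The complement of (0, 1) lies in ]-oo, 0] together with ]x, +oo[, of total mass 1 - F(x) <= e. *)
apply: (@le_trans _ _ (mu (`]-oo, 0]%classic `|` ~` `]-oo, x]%classic))).
  apply: le_measure; rewrite ?inE.
  - by apply: measurableC; exact: measurable_itv.
  - by apply: measurableU => //; exact: measurableC.
  - move=> y /= /negP; rewrite !in_itv/= negb_and -!leNgt => /orP[y0|y1]; [by left|right].
    by apply/negP; rewrite -ltNge (lt_le_trans x1).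
apply: (@le_trans _ _ (mu `]-oo, 0%R]%classic + mu (~` `]-oo, x]%classic))%E).
  by apply: measureU2 => //; exact: measurableC.
by rewrite probability_setC// !muF F0// add0e -EFinB lee_fin; lra.
Qed.

End existence.

(** * Application to the iterated function system *)

Lemma C1_near01_derivable (R : realType) (f : R -> R) (a : R) :
  a \in `[0, 1] -> C1_near01 f a -> derivable01 f a.
Proof. by move=> a01 [U [[oU Ua] dU _]]; apply: dU; split. Qed.

Theorem theorem1 (R : realType) (N : nat) (f : 'I_N -> R -> R) (p : 'I_N -> R)
    (fp_adm : admissible f p) :
  exists mu : probability (measurableTypeR R) R,
    [/\ in_M1_open01 mu /\ eq_borel01 (markov_op f p mu) mu,
        (forall nu : probability (measurableTypeR R) R,
           in_M1_open01 nu -> eq_borel01 (markov_op f p nu) nu ->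
           eq_borel01 nu mu) &
        (forall x : R, 0 < x < 1 -> mu [set x] = 0%E)].
Proof.
case: fp_adm => f_Hplus p_gt0 p_sum f_move d0_gt0 d1_gt0 drift0 drift1.
have /(_ _)/cid-/all_tag[g0 g0P] i : exists g : R -> R,
    [/\ set_fun `[0, 1] `[0, 1] (f i), set_fun `[0, 1] `[0, 1] g,
    {in `[0, 1], cancel (f i) g} & {in `[0, 1], cancel g (f i)}].
  by have [[_ [g [_ ? ? ? ?]]] _ _ _] := f_Hplus i; exists g.
have f01 i : set_fun `[0, 1] `[0, 1] (f i) by have [] := g0P i.
have f_lt01 i : {in `[0, 1] &, {homo f i : x y / x < y}} by have [] := f_Hplus i.
pose h i := extend01 _ (f i); pose g i := extend01 _ (g0 i).
have h_lt i : {homo h i : x y / x < y} by exact: extend01_lt.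
have hK i : cancel (h i) (g i) by have [? ? ? ?] := g0P i; exact: extend01K.
have gK i : cancel (g i) (h i) by have [? ? ? ?] := g0P i; exact: extend01K.
have g_lt i : {homo g i : x y / x < y}.
  move=> x y xy; rewrite ltNge; apply/negP; rewrite le_eqVlt => /predU1P[gxy|/(h_lt i)].
    by move: xy; rewrite -(gK i x) -gxy gK ltxx.
  by rewrite !gK ltNge (ltW xy).
have f_fix i : f i 0 = 0 /\ f i 1 = 1 by have [? ? ? ?] := g0P i; exact: (extend01_fix _ (f i) (g0 i)).
have hE i x : 0 <= x <= 1 -> h i x = f i x by move=> x01; rewrite /h /extend01 in_itv/= x01.
have h0 i : h i 0 = 0 by rewrite hE ?lexx ?ler01//; have [] := f_fix i.
have h1 i : h i 1 = 1 by rewrite hE ?lexx ?ler01//; have [] := f_fix i.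
have g_0 i : g i 0 = 0 by rewrite -{1}(h0 i) hK.
have g_1 i : g i 1 = 1 by rewrite -{1}(h1 i) hK.
have g01 i x : 0 < x < 1 -> 0 < g i x < 1.
  by move=> /andP[x0 x1]; rewrite -{1}(g_0 i) -(g_1 i) !g_lt.
have g_push x : 0 < x < 1 -> exists i, g i x < x.
  move=> x01; have [_ [j /andP[_ xj]]] := f_move x x01; exists j.
  rewrite -[ltRHS](hK j) g_lt// hE//; lra.
have h_ge0 i c : c < deriv01 (f i) 0 ->
    exists2 r, 0 < r & forall x, 0 < x < r -> c * x <= h i x.
  have /C1_near01_derivable df0 : C1_near01 (f i) 0 by have [] := f_Hplus i.
  move=> /(deriv01_gt _ _ _ _ (df0 _))[|r r_gt0 fr]; first by rewrite in_itv/= lexx ler01.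
  exists (Num.min r 1); first by rewrite lt_min r_gt0 ltr01.
  move=> x /andP[x0]; rewrite lt_min => /andP[xr x1].
  have := fr x; rewrite (ltW x0) (ltW x1) gt_eqF// subr0 gtr0_norm// xr.
  rewrite (f_fix i).1 subr0 ltr_pdivlMr// => /(_ isT isT isT)/ltW.
  by rewrite hE// (ltW x0) (ltW x1).
(* At the point 1 - x the difference quotient based at 1 is (1 - f_i(1 - x)) / x, which is the slope
   at 0 of the reflected map. *)
have h_ge1 i c : c < deriv01 (f i) 1 ->
    exists2 r, 0 < r & forall x, 0 < x < r -> c * x <= 1 - h i (1 - x).
  have /C1_near01_derivable df1 : C1_near01 (f i) 1 by have [] := f_Hplus i.
  move=> /(deriv01_gt _ _ _ _ (df1 _))[|r r_gt0 fr]; first by rewrite in_itv/= lexx ler01.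
  exists (Num.min r 1); first by rewrite lt_min r_gt0 ltr01.
  move=> x /andP[x0]; rewrite lt_min => /andP[xr x1].
  have x01 : 0 <= 1 - x <= 1 by lra.
  have := fr (1 - x) x01.
  have -> : 1 - x - 1 = - x by lra.
  rewrite normrN gtr0_norm// xr (f_fix i).2 lt_eqF ?gtrBl// => /(_ isT isT)/ltW.
  by rewrite invrN mulrN -mulNr opprB ler_pdivlMr// hE.
have [mu mu01 mu_inv] := invariant_exists _ _ _ p_gt0 p_sum g h _ _ g_lt h_lt hK gK h0 h1
  d0_gt0 drift0 h_ge0 d1_gt0 drift1 h_ge1.
exists mu; split.
- split; first exact/in_M1_open01P.
  move=> A mA A01; rewrite -(mu_inv _ mA); apply: eq_bigr => i _.
  by rewrite extend01_preimage.
- move=> nu /in_M1_open01P nu01 nu_inv A mA _.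
  apply: (invariant_unique _ _ _ p_gt0 p_sum g h g_lt h_lt hK gK g01 g_push) => //.
  move=> B mB.
  have mI : measurable (`]0, 1[%classic : set (measurableTypeR R)) by exact: measurable_itv.
  (* Invariance of [nu] is known only for subsets of [0, 1], so B is replaced by its trace on (0,
     1). The extended maps preserve (0, 1), so the preimage of the trace is the trace of the
     preimage. *)
  rewrite -[RHS](measure_setI01 _ _ nu01)// -nu_inv; last 2 first.
  + exact: measurableI.
  + by move=> x [_]; rewrite /= !in_itv/= => /andP[x0 x1]; rewrite !ltW.
  apply: eq_bigr => i _; congr (_ * _)%E.
  rewrite -(measure_setI01 _ _ nu01); last exact: (preimage_measurable _ _ h).
  rewrite -extend01_preimage//; last first.
    by move=> x [_]; rewrite /= !in_itv/= => /andP[x0 x1]; rewrite !ltW.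
  congr (nu _); rewrite preimage_setI; congr (_ `&` _).
  apply/seteqP; split => x; rewrite /= !in_itv/= => /andP[x0 x1].
    by rewrite -{1}(h0 i) -(h1 i) !h_lt.
  by have := g01 i (h i x); rewrite hK x0 x1 => /(_ isT).
- exact: (invariant_atomless _ _ _ p_gt0 p_sum g h g_lt h_lt hK gK g01 g_push).
Qed.
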